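(* There is an absolute constant $C>0$ such that for every odd prime power $q$ and every $K\subset\mathbb{H}^1(\mathbb{F}_q)$, \[ |K|\le C\left(\frac{|\pi_1(K)|\,|\pi_2(K)|}{q}+q^{1/2}\sqrt{|\pi_1(K)|\,|\pi_2(K)|}\right). \] In particular, there is an absolute constant $c>0$ with $\max\{|\pi_1(K)|,|\pi_2(K)|\}\ge c\min\{|K|^{1/2}q^{1/2},\ |K|q^{-1/2}\}$.
   Context: $\mathbb{H}^1(\mathbb{F}_q)$ is $\mathbb{F}_q^3$ with product $(x_1,x_2,t)\cdot(x_1',x_2',t')=(x_1+x_1',x_2+x_2',t+t'+\tfrac12(x_1x_2'-x_2x_1'))$. The projections $\pi_1,\pi_2:\mathbb{H}^1(\mathbb{F}_q)\to\mathbb{F}_q^2$ are $\pi_1(x_1,x_2,t)=(x_2,\,t+\tfrac12x_1x_2)$ and $\pi_2(x_1,x_2,t)=(x_1,\,t-\tfrac12x_1x_2)$. *)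

(* Defs.v *)
From HB Require Import structures.
From mathcomp Require Import all_boot all_order all_algebra all_fingroup.
From mathcomp Require Import ring.

Set Implicit Arguments.
Unset Strict Implicit.
Unset Printing Implicit Defensive.

Import GRing.Theory.
Local Open Scope ring_scope.

(* An alias, so that the group law below does not clash with the
   componentwise one on products. *)
Definition heisenberg (F : finFieldType) : Type := (F * F * F)%type.

HB.instance Definition _ (F : finFieldType) := Finite.on (heisenberg F).

Section Heisenberg.
Variable F : finFieldType.
Implicit Types p : heisenberg F.

Definition heis_mul p p' : heisenberg F :=
  let: (x1, x2, t) := p in
  let: (x1', x2', t') := p' in
  (x1 + x1', x2 + x2', t + t' + 2%:R^-1 * (x1 * x2' - x2 * x1')).

Definition heis_one : heisenberg F := (0, 0, 0).

Definition heis_inv p : heisenberg F :=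
  let: (x1, x2, t) := p in (- x1, - x2, - t).

Lemma heis_mulA : associative heis_mul.
Proof.
move=> [[a b] s] [[a' b'] s'] [[a'' b''] s''] /=.
by congr (_, _, _); rewrite ?addrA //; ring.
Qed.

Lemma heis_mul1 : left_id heis_one heis_mul.
Proof. by move=> [[a b] s]; congr (_, _, _); ring. Qed.

Lemma heis_mulV : left_inverse heis_one heis_inv heis_mul.
Proof. by move=> [[a b] s]; congr (_, _, _); ring. Qed.

HB.instance Definition _ :=
  Finite_isGroup.Build (heisenberg F) heis_mulA heis_mul1 heis_mulV.

Definition heis_pi1 p : F * F :=
  let: (x1, x2, t) := p in (x2, t + 2%:R^-1 * x1 * x2).

Definition heis_pi2 p : F * F :=
  let: (x1, x2, t) := p in (x1, t - 2%:R^-1 * x1 * x2).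

End Heisenberg.

(* Main.v *)
Require Import Defs.
From mathcomp Require Import all_boot all_order all_algebra all_fingroup.
From mathcomp Require Import cyclic reals.
From mathcomp Require Import ring lra.

(** With [pi_1 p = (a, b)] and [pi_2 p = (c, d)] one has [b = a c + d], and [p]
    is determined by [pi_1 p] and [pi_2 p].  Hence [K] injects into the
    incidences between the points [pi_1 K] and the non-vertical lines [pi_2 K]
    of the affine plane, and the bound is the Szemeredi-Trotter type inequality
    [I <= |P||L|/q + sqrt(q |P||L|)].  The latter follows from a second moment
    computation: as [l] ranges over all [q^2] lines, [|P inter l|] has mean
    [|P|/q], and the sum of the squared deviations is at most [q |P|], because
    two distinct points lie on at most one common line. *)

Import Order.TTheory GRing.Theory Num.Theory.
Local Open Scope ring_scope.

Section CauchySchwarz.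
Variables (R : realFieldType) (T : finType).

(** Cauchy-Schwarz against the constant 1: the squared deviations of [f] from its mean [S / n] over
    [B] add up to [Q - S ^+ 2 / n], which is therefore nonnegative. *)
Lemma sqr_sum_le_card (B : {set T}) (f : T -> R) :
  (\sum_(i in B) f i) ^+ 2 <= #|B|%:R * \sum_(i in B) f i ^+ 2.
Proof.
set S := \sum_(i in B) f i; set Q := \sum_(i in B) f i ^+ 2.
have [B0|Bn0] := eqVneq B set0.
  by rewrite /S /Q B0 !big_set0 expr2 !mulr0.
have n_gt0 : 0 < #|B|%:R :> R by rewrite ltr0n card_gt0.
set n : R := #|B|%:R in n_gt0 *.
have n0 : n != 0 by rewrite gt_eqF.
have : 0 <= \sum_(i in B) (f i - S / n) ^+ 2.
  by apply: sumr_ge0 => i _; exact: sqr_ge0.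
have -> : \sum_(i in B) (f i - S / n) ^+ 2 = Q - S ^+ 2 / n.
  under eq_bigr => i _ do rewrite sqrrB -mulrnAl -mulr_natl.
  rewrite big_split sumrB /= -/Q -mulr_suml -mulr_sumr -/S sumr_const.
  by rewrite -mulr_natl -/n; field.
by rewrite subr_ge0 ler_pdivrMr // mulrC.
Qed.

End CauchySchwarz.

(** If 2 vanished, the additive order of 1 would divide both 2 and the odd number [#|F|], forcing 1
    = 0. *)
Lemma odd_card_two_neq0 (F : finFieldType) : odd #|F| -> 2%:R != 0 :> F.
Proof.
move=> oddq; apply/eqP => two0.
have : (#[1%R : F]%g %| gcdn 2 #|F|)%N.
  rewrite dvdn_gcd order_dvdn FinRing.zmodXgE two0 -cardsT order_dvdG ?inE // andbT.
  exact: eqxx.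
have -> : gcdn 2 #|F| = 1%N by apply/eqP; rewrite -/(coprime _ _) coprime2n.
by rewrite dvdn1 order_eq1 => /eqP /eqP; rewrite (negbTE (oner_neq0 F)).
Qed.

Section Incidences.
Variables (R : rcfType) (F : finFieldType).
Implicit Types (p l : F * F) (A B : {set F * F}).

(** The point [(a, b)] lies on the line [y = c x + d] encoded by [(c, d)]. *)
Definition incident p l : bool := p.2 == p.1 * l.1 + l.2.

Let q : R := #|F|%:R.

Lemma sum_indicator (T : finType) (P : pred T) :
  \sum_x (P x)%:R = #|[set x | P x]|%:R :> R.
Proof.
rewrite -natr_sum -sum1_card [in RHS]big_mkcond /=; congr _%:R.
by apply: eq_bigr => x _; rewrite inE; case: (P x).
Qed.

(** The slope [c] parametrizes the non-vertical lines through [p]. *)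
Lemma sum_incident p : \sum_l (incident p l)%:R = q.
Proof.
rewrite sum_indicator; congr _%:R.
have -> : [set l | incident p l] = [set (c, p.2 - p.1 * c) | c : F].
  apply/setP => -[c d]; rewrite inE /incident /=.
  apply/eqP/imsetP => [->|[c' _ [-> ->]]]; last by ring.
  by exists c => //; congr (_, _); ring.
by rewrite card_imset // => c c' [].
Qed.

(** Only an inequality, because two distinct points with the same abscissa share no non-vertical
    line. *)
Lemma sum_incident2_le p p' :
  \sum_l (incident p l)%:R * (incident p' l)%:R <= 1 + (p == p')%:R * q :> R.
Proof.
have [<-|pp'] := eqVneq p p'.
  rewrite mul1r; under eq_bigr => l _ do rewrite -natrM mulnb andbb.
  by rewrite sum_incident lerDr.
rewrite mul0r addr0; under eq_bigr => l _ do rewrite -natrM mulnb.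
rewrite sum_indicator lern1; apply/card_le1_eqP => -[c d] [c' d'].
rewrite !inE /incident /=; case: p p' pp' => [a b] [a' b'] /= pp'.
move=> /andP[/eqP e1 /eqP e2] /andP[/eqP e3 /eqP e4].
(* Combining the four incidence equations gives [(a - a') * (c - c') = 0], and [a = a'] would make
   the two points equal. *)
have eqc : c = c'.
  have /eqP : (a - a') * (c - c') = 0.
    have -> : (a - a') * (c - c')
      = (a * c + d) - (a' * c + d) - (a * c' + d') + (a' * c' + d') by ring.
    by rewrite -e1 -e2 -e3 -e4; ring.
  rewrite mulf_eq0 !subr_eq0 => /orP[/eqP eqa|/eqP //].
  by move: pp'; rewrite e1 e2 eqa eqxx.
by congr (_, _) => //; apply: (addrI (a * c)); rewrite -e1 eqc.
Qed.

Let deg A l : R := \sum_(p in A) (incident p l)%:R.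

Lemma deviation_le A :
  \sum_l (deg A l - #|A|%:R / q) ^+ 2 <= q * #|A|%:R.
Proof.
set n : R := #|A|%:R.
have q0 : q != 0 by rewrite pnatr_eq0 -lt0n; apply/card_gt0P; exists 0.
have deg1 : \sum_l deg A l = q * n.
  rewrite exchange_big /=; under eq_bigr => p _ do rewrite sum_incident.
  by rewrite sumr_const mulr_natr.
(* The second moment counts, over ordered pairs of points of [A], their common lines; the diagonal
   pairs contribute the extra [q * n]. *)
have deg2 : \sum_l deg A l ^+ 2 <= n ^+ 2 + q * n.
  under eq_bigr => l _ do rewrite expr2 big_distrlr /=.
  rewrite exchange_big /=.
  have -> : n ^+ 2 + q * n = \sum_(p in A) (n + q).
    by rewrite sumr_const -mulr_natr -/n; ring.
  apply: ler_sum => p pA; rewrite exchange_big /=.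
  have -> : n + q = \sum_(p' in A) (1 + (p == p')%:R * q).
    rewrite big_split /= sumr_const -mulr_suml -/n; congr (_ + _).
    rewrite (bigD1 p) //= eqxx big1 ?addr0 ?mul1r // => p' /andP[_ p'p].
    by rewrite eq_sym (negbTE p'p).
  by apply: ler_sum => p' _; exact: sum_incident2_le.
under eq_bigr => l _ do rewrite sqrrB -mulrnAl -mulr_natl.
rewrite big_split sumrB /= -mulr_suml -mulr_sumr deg1 sumr_const.
rewrite -[_ *+ #|_|]mulr_natl card_prod natrM -/q.
have -> : 2 * (q * n) * (n / q) = 2 * n ^+ 2 by field.
have -> : q * q * (n / q) ^+ 2 = n ^+ 2 by field.
lra.
Qed.

Lemma incidence_le A B :
  \sum_(l in B) deg A l <=
    #|A|%:R * #|B|%:R / q + Num.sqrt q * Num.sqrt (#|A|%:R * #|B|%:R).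
Proof.
have q_ge0 : 0 <= q by [].
set D := \sum_(l in B) (deg A l - #|A|%:R / q).
have -> : \sum_(l in B) deg A l = #|A|%:R * #|B|%:R / q + D.
  by rewrite /D sumrB sumr_const -mulr_natr; ring.
rewrite lerD2l -sqrtrM // (le_trans (ler_norm _)) // -sqrtr_sqr ler_wsqrtr //.
apply: le_trans (sqr_sum_le_card _ _ _ _) _.
rewrite mulrA [leRHS]mulrC ler_wpM2l //.
(* The squared deviations over [B] are at most those over all lines. *)
apply: le_trans (deviation_le A); rewrite [leRHS](bigID (mem B)) /= lerDl.
by apply: sumr_ge0 => l _; exact: sqr_ge0.
Qed.

Lemma card_heisenberg_le (K : {set heisenberg F}) :
  let k1 : R := #|@heis_pi1 F @: K|%:R in
  let k2 : R := #|@heis_pi2 F @: K|%:R in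
  odd #|F| ->
  #|K|%:R <= k1 * k2 / q + Num.sqrt q * Num.sqrt (k1 * k2).
Proof.
move=> k1 k2 oddq; apply: le_trans (incidence_le _ _).
have two_neq0 := odd_card_two_neq0 F oddq.
pose h (p : heisenberg F) := (heis_pi1 p, heis_pi2 p) : (F * F) * (F * F).
have h_inj : injective h.
  move=> [[x y] t] [[x' y'] t'] [ey et ex _].
  by move: et; rewrite ex ey => /addIr ->.
rewrite /deg exchange_big /= pair_big /= -(card_imset K h_inj) -sum1_card natr_sum.
rewrite [leRHS]big_mkcond [leLHS]big_mkcond /=; apply: ler_sum => pl _.
case: ifP => [/imsetP[p pK ->] /=|_]; last by case: ifP.
rewrite !imset_f // (_ : incident _ _) //.
(* The incidence reads [t + xy/2 = yx + (t - xy/2)], which uses that 2 is invertible. *)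
by case: p {pK} => [[x y] t]; apply/eqP => /=; field.
Qed.

End Incidences.

Theorem theorem1p6 (R : realType) :
  (exists C : R, 0 < C /\
    forall (q : nat) (F : finFieldType), odd q -> #|F| = q ->
    forall K : {set heisenberg F},
      let k  : R := #|K|%:R in
      let k1 : R := #|@heis_pi1 F @: K|%:R in
      let k2 : R := #|@heis_pi2 F @: K|%:R in
      k <= C * (k1 * k2 / q%:R + Num.sqrt q%:R * Num.sqrt (k1 * k2)))
  /\
  (exists c : R, 0 < c /\
    forall (q : nat) (F : finFieldType), odd q -> #|F| = q ->
    forall K : {set heisenberg F},
      let k  : R := #|K|%:R in
      let k1 : R := #|@heis_pi1 F @: K|%:R in
      let k2 : R := #|@heis_pi2 F @: K|%:R in
      c * Num.min (Num.sqrt k * Num.sqrt q%:R) (k / Num.sqrt q%:R)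
        <= Num.max k1 k2).
Proof.
split.
  exists 1; split; first exact: ltr01.
  move=> q F oddq Fq K /=.
  by rewrite mul1r -Fq; apply: card_heisenberg_le; rewrite Fq.
(* With c = 1/2, a failure makes the two terms of the first bound at most k/4 and less than k/2
   respectively, so k < 3k/4, which is absurd for k >= 0. *)
exists 2^-1; split; first by rewrite invr_gt0.
move=> q F oddq Fq K /=.
set k : R := #|K|%:R; set k1 : R := #|@heis_pi1 F @: K|%:R.
set k2 : R := #|@heis_pi2 F @: K|%:R.
rewrite leNgt; apply/negP => M_lt.
have := @card_heisenberg_le R F K; rewrite /= Fq -/k -/k1 -/k2 => /(_ oddq).
have q_gt0 : 0 < q%:R :> R by rewrite ltr0n odd_gt0.
have k1_ge0 : 0 <= k1 by []. have k2_ge0 : 0 <= k2 by []. have k_ge0 : 0 <= k by [].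
set M := Num.max k1 k2 in M_lt.
have M_ge0 : 0 <= M by rewrite le_max k1_ge0.
have kM : k1 * k2 <= M ^+ 2.
  by rewrite expr2 ler_pM // le_max lexx ?orbT.
set r := Num.sqrt q%:R in M_lt *.
have r_gt0 : 0 < r by rewrite sqrtr_gt0.
have qE : q%:R = r ^+ 2 :> R by rewrite sqr_sqrtr // ltW.
set s := Num.sqrt k in M_lt.
have s_ge0 : 0 <= s := sqrtr_ge0 _.
have kE : k = s ^+ 2 by rewrite sqr_sqrtr.
have [M1 M2] : M < s * r / 2 /\ M < k / r / 2.
  have h : M * 2 < Num.min (s * r) (k / r).
    by rewrite -ltr_pdivlMr // mulrC.
  by move: h; rewrite lt_min => /andP[h1 h2]; split; rewrite ltr_pdivlMr.
have e1 : k1 * k2 / q%:R <= k / 4.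
  rewrite ler_pdivrMr //; apply: le_trans kM _; rewrite qE kE.
  have -> : s ^+ 2 / 4 * r ^+ 2 = (s * r / 2) ^+ 2 by field.
  by rewrite lerXn2r ?nnegrE ?(ltW M1) // (le_trans M_ge0 (ltW M1)).
have e2 : r * Num.sqrt (k1 * k2) < k / 2.
  apply: (@le_lt_trans _ _ (r * M)).
    rewrite ler_pM2l // -(ger0_norm M_ge0) -sqrtr_sqr.
    exact: ler_wsqrtr.
  rewrite mulrC -ltr_pdivlMr //.
  by rewrite (_ : k / 2 / r = k / r / 2) //; field; rewrite gt_eqF.
lra.
Qed.
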